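(* Let $\Gamma$ be a (not necessarily finite) subgroup of $GL_k(\mathbb{C})$ with defining representation $\pi$ on $\mathbb{C}^k$, and let $n\ge1$. Let $\Gamma_n$ act on $\mathbb{C}^{kn}=(\mathbb{C}^k)^n$. Then the virtual characters $\lambda(\mathbb{C}^{kn}):=\sum_{i=0}^{kn}(-1)^i\Lambda^i\mathbb{C}^{kn}$ and $\eta_n(\lambda(\pi))$ of $\Gamma_n$ are equal. Here $\lambda(\pi)=\sum_{i=0}^k(-1)^i\Lambda^i\pi$.
   Context: $\Gamma_n=\Gamma^n\rtimes S_n$ is the wreath product, with multiplication $(g,\sigma)(h,\tau)=(g\,\sigma(h),\sigma\tau)$ and $S_n$ permuting the factors of $\Gamma^n$. It acts on $(\mathbb{C}^k)^n$ by letting $\Gamma^n$ act factorwise via $\pi$ and $S_n$ permute the factors; $\Lambda^i\mathbb{C}^{kn}$ carries the induced action. For a representation $V$ of $\Gamma$ with character $\gamma$, $\eta_n(\gamma)$ is the character of $V^{\otimes n}$, on which $\Gamma^n$ acts factor by factor and $S_n$ permutes the factors. $\varepsilon_n(\gamma)$ is the character of $\varepsilon_n\otimes V^{\otimes n}$, where $\varepsilon_n$ is the one-dimensional representation of $\Gamma_n$ that is trivial on $\Gamma^n$ and the sign on $S_n$. $\eta_n$ is extended to virtual characters by the rule, for characters $\beta,\gamma$ of $\Gamma$: $\eta_n(\beta-\gamma)=\sum_{m=0}^n(-1)^m\mathrm{Ind}^{\Gamma_n}_{\Gamma_{n-m}\times\Gamma_m}\big[\eta_{n-m}(\beta)\otimes\varepsilon_m(\gamma)\big]$.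 In particular $\eta_n(\lambda(\pi))$ is obtained with $\beta=\sum_{i\text{ even}}\Lambda^i\pi$ and $\gamma=\sum_{i\text{ odd}}\Lambda^i\pi$. *)

(* Defs.v *)
From HB Require Import structures.
From mathcomp Require Import all_boot all_order all_algebra all_fingroup.
From mathcomp Require Import complex.
From mathcomp Require Export reals.
Set Implicit Arguments. Unset Strict Implicit. Unset Printing Implicit Defensive.
Import Order.TTheory GRing.Theory Num.Theory.
Local Open Scope ring_scope.

Definition Cplx (R : realType) : numClosedFieldType := R[i].

Section Defs.
Variable F : comNzRingType.

(* Linear maps of F^T (T a finite index type = the standard basis) are given
   by their matrices, as functions T -> T -> F : entry (row, column). *)

Definition minor (T : finType) (A : T -> T -> F) (Y X : {set T}) : F :=
  match #|Y| =P #|X| with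
  | ReflectT e =>
      \det (\matrix_(a < #|X|, b < #|X|)
              A (enum_val (cast_ord (esym e) a)) (enum_val b))
  | ReflectF _ => 0
  end.

(* Matrix of Lambda^* A (the whole exterior algebra) in the standard basis
   e_X = e_{x_1} /\ ... /\ e_{x_m} (x_1 < ... < x_m), indexed by X : {set T}:
   the coefficient of e_Y in (Lambda A) e_X. *)
Definition extmx (T : finType) (A : T -> T -> F) (Y X : {set T}) : F :=
  minor A Y X.

Definition trExt (T : finType) (i : nat) (A : T -> T -> F) : F :=
  \sum_(X : {set T} | #|X| == i) extmx A X X.

Definition lambdaTr (T : finType) (A : T -> T -> F) : F :=
  \sum_(i < #|T|.+1) (-1) ^+ i * trExt i A.

End Defs.

(* Elements of Gamma_n = Gamma^n x| S_n are pairs (g, s) with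
   g : 'I_n -> 'M_k and s : 'S_n; multiplication
   (g,s)(h,t) = (g s(h), s t), where s(h)_i = h_(s^-1 i).
   (g,s) acts on (C^k)^n by  (g,s).(v_j)_j = (g_i v_(s^-1 i))_i. *)

Definition wreathMx (F : comNzRingType) (k n : nat) (g : 'I_n -> 'M[F]_k)
    (s : 'S_n) : ('I_n * 'I_k)%type -> ('I_n * 'I_k)%type -> F :=
  fun ir jc => if ir.1 == s jc.1 then g ir.1 ir.2 jc.2 else 0.

Definition lambdaCkn (F : comNzRingType) (k n : nat) (g : 'I_n -> 'M[F]_k)
    (s : 'S_n) : F :=
  lambdaTr (wreathMx g s).

(* Character of Gamma_p on the tensor space whose i-th factor has basis
   {X : {set 'I_k} | P i X} (P i X = parity condition), factor i being the
   representation g |-> Lambda g restricted to that basis (a direct sum of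
   exterior powers of pi), Gamma^p acting factorwise, S_p permuting the
   factors.  The basis of the tensor product is the set of functions
   a with a i in the basis of factor i; the diagonal coefficient of (g,s) at
   e_a is prod_i (Lambda g_i)[a_i, a_(s^-1 i)]. *)
Definition tensTr (F : comNzRingType) (k p : nat) (P : 'I_p -> pred {set 'I_k})
    (g : 'I_p -> 'M[F]_k) (s : 'S_p) : F :=
  \sum_(a : {ffun 'I_p -> {set 'I_k}} | [forall i, P i (a i)])
     \prod_(i < p) extmx (fun r c => g i r c) (a i) (a ((s^-1)%g i)).

(* Block L_m = {n-m, ..., n-1} of 'I_n: the slots of the Gamma_m factor in
   Gamma_(n-m) x Gamma_m <= Gamma_n. *)
Definition lastBlock (n m : nat) : {set 'I_n} := [set i : 'I_n | (n - m <= i)%N].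

(* (g,s) lies in Gamma_(n-m) x Gamma_m iff s stabilises the block L_m. *)
Definition inYoung (n m : nat) (s : 'S_n) : bool :=
  [forall i : 'I_n, (s i \in lastBlock n m) == (i \in lastBlock n m)].

(* Character of eta_(n-m)(beta) (x) eps_m(gamma) on Gamma_(n-m) x Gamma_m
   (embedded in Gamma_n), with beta = sum_(i even) Lambda^i pi (basis: even
   subsets) and gamma = sum_(i odd) Lambda^i pi (basis: odd subsets); the
   sign character eps_m is the sign of the restriction of s to the block L_m. *)
Definition etaEpsTr (F : comNzRingType) (k n m : nat) (g : 'I_n -> 'M[F]_k)
    (s : 'S_n) : F :=
  (-1) ^+ odd_perm (restr_perm (lastBlock n m) s) *
  tensTr (fun i X => odd #|X| == (i \in lastBlock n m)) g s.

(* Induced character Ind_(Gamma_(n-m) x Gamma_m)^(Gamma_n) at x = (g,s):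
   (1/|S_(n-m) x S_m|) sum over t in S_n (i.e. over (1,t) in Gamma_n, which
   cover every coset exactly (n-m)! m! times) with
   (1,t)^-1 x (1,t) = (g o t, t^-1 s t) in the subgroup.
   In MathComp (t * u) i = u (t i), so t^-1 s t is written (t * s * t^-1)%g. *)
Definition indEtaEps (F : fieldType) (k n m : nat) (g : 'I_n -> 'M[F]_k)
    (s : 'S_n) : F :=
  ((n - m)`! * m`!)%N%:R^-1 *
  \sum_(t : 'S_n | inYoung m (t * s * t^-1)%g)
     etaEpsTr m (fun i => g (t i)) (t * s * t^-1)%g.

(* eta_n(lambda(pi)) = eta_n(beta - gamma) at (g,s). *)
Definition etaLambda (F : fieldType) (k n : nat) (g : 'I_n -> 'M[F]_k)
    (s : 'S_n) : F :=
  \sum_(m < n.+1) (-1) ^+ m * indEtaEps m g s.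

(* Main.v *)
(* Both sides are the same sum over the families a = (a_i) of subsets of
   {0, ..., k-1}, a_i being the basis vector in the i-th slot.

   Left side.  A subset X of the basis of C^(kn) is such a family, and the
   principal minor of (g,s) on X vanishes unless #|a_i| is constant on the cycles
   of s.  In that case, after reordering each a_i, the matrix is block diagonal,
   with determinant prod_i minor(g_i; a_i, a_(s^-1 i)), times a permutation matrix
   moving (i,u) to (s i,u) for u < #|a_i|.  The sign of the latter is the product
   over u of the signs of s on {i | u < #|a_i|}; a cycle occurs in #|a_i| of these
   sets, so this is the sign of s on the set M of slots with #|a_i| odd.

   Right side.  Summing over t in S_n amounts, up to the factor m!(n-m)!, to
   summing over the images M of the last block, and M is then recovered from a
   as the set of slots with #|a_i| odd.  Finally (-1)^#|X| = (-1)^#|M|. *)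

Require Import Defs.
From HB Require Import structures.
From mathcomp Require Import all_boot all_order all_algebra all_fingroup.
From mathcomp Require Import complex reals.
Set Implicit Arguments.
Unset Strict Implicit.
Unset Printing Implicit Defensive.
Import GRing.Theory.
Local Open Scope ring_scope.

(** * Extending permutations along an injection *)

Section PushPerm.
Variables (S T : finType) (f : S -> T).
Hypothesis f_inj : injective f.

Definition push_fun (q : {perm S}) (x : T) : T :=
  if [pick a | f a == x] is Some a then f (q a) else x.

Lemma push_fun_im q a : push_fun q (f a) = f (q a).
Proof.
rewrite /push_fun; case: pickP => [b /eqP/f_inj-> // | /(_ a)].
by rewrite eqxx.
Qed.

Lemma push_fun_notin q x : x \notin codom f -> push_fun q x = x.
Proof.
rewrite /push_fun; case: pickP => // a /eqP<-; by rewrite codom_f.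
Qed.

Lemma push_fun_inj q : injective (push_fun q).
Proof.
apply: (can_inj (g := push_fun q^-1%g)) => x.
have [/codomP[a ->]|xf] := boolP (x \in codom f); last by rewrite !push_fun_notin.
by rewrite !push_fun_im permK.
Qed.

Definition push_perm q : {perm T} := perm (@push_fun_inj q).

Lemma push_perm_im q a : push_perm q (f a) = f (q a).
Proof. by rewrite permE push_fun_im. Qed.

Lemma push_perm_notin q x : x \notin codom f -> push_perm q x = x.
Proof. by rewrite permE; apply: push_fun_notin. Qed.

Lemma push_permM q r : push_perm (q * r)%g = (push_perm q * push_perm r)%g.
Proof.
apply/permP => x; rewrite permM.
have [/codomP[a ->]|xf] := boolP (x \in codom f); last by rewrite !push_perm_notin.
by rewrite !push_perm_im permM.
Qed.

Lemma push_perm1 : push_perm 1%g = 1%g.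
Proof.
by apply: (mulgI (push_perm 1%g)); rewrite -push_permM !mulg1.
Qed.

Lemma push_tperm a b : push_perm (tperm a b) = tperm (f a) (f b).
Proof.
apply/permP => x.
have [/codomP[c ->]|xf] := boolP (x \in codom f).
  by rewrite push_perm_im inj_tperm.
rewrite push_perm_notin // tpermD //; apply: contraNneq xf => <-; exact: codom_f.
Qed.

(** Write [q] as a product of transpositions: each is pushed to a transposition, so their number is
    unchanged. *)
Lemma odd_push_perm q : odd_perm (push_perm q) = odd_perm q.
Proof.
have [ts -> dts] := prod_tpermP q; rewrite odd_perm_prod //.
have -> : push_perm (\prod_(t <- ts) tperm t.1 t.2)%g
    = (\prod_(t <- [seq (f t.1, f t.2) | t <- ts]) tperm t.1 t.2)%g.
  rewrite big_map (big_morph _ push_permM push_perm1).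
  by apply: eq_bigr => t _; rewrite push_tperm.
rewrite odd_perm_prod ?size_map // all_map.
by apply: sub_all dts => -[a b]; rewrite /dpair /= (inj_eq f_inj).
Qed.

Lemma push_perm_inj : injective push_perm.
Proof.
move=> q r eqr; apply/permP => a; apply: f_inj.
by rewrite -!push_perm_im eqr.
Qed.

(** Identifies the image of [push_perm], so that a sum over [{perm T}] can be cut down to one over
    [{perm S}]. *)
Lemma push_perm_surj (p : {perm T}) :
  (forall x, x \notin codom f -> p x = x) -> exists q, p = push_perm q.
Proof.
move=> pfix.
have pf a : p (f a) \in codom f.
  apply/negPn/negP => pfa; have /perm_inj faE := pfix _ pfa.
  by rewrite faE codom_f in pfa.
pose h a := iinv (pf a).
have hE a : f (h a) = p (f a) by rewrite f_iinv.
have h_inj : injective h.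
  by move=> a b /(congr1 f); rewrite !hE => /perm_inj/f_inj.
exists (perm h_inj); apply/permP => x.
have [/codomP[a ->]|xf] := boolP (x \in codom f).
  by rewrite push_perm_im permE hE.
by rewrite push_perm_notin // pfix.
Qed.

End PushPerm.

(** * Sign of a permutation that preserves every fibre *)

Section SignGlue.
Variables (I J T : finType) (f : I -> J -> T).
Hypothesis f_inj : forall i i' j j', f i j = f i' j' -> i = i' /\ j = j'.
Hypothesis f_surj : forall x, exists i j, x = f i j.

Let fi_inj i : injective (f i).
Proof. by move=> j j' /f_inj[]. Qed.

(** The fibres are disjoint, so only the factor of index [i] can move [f i j]; [uniq r] makes it
    occur at most once. *)
Lemma prod_push_permE (Q : I -> {perm J}) (r : seq I) i j : uniq r ->
  (\prod_(i <- r) push_perm (@fi_inj i) (Q i))%g (f i j)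
    = f i (if i \in r then Q i j else j).
Proof.
elim: r i j => [|i0 r IHr] i j; first by rewrite big_nil perm1.
rewrite big_cons permM in_cons /= => /andP[i0r Ur].
have [->|ii0] /= := eqVneq i i0.
  by rewrite push_perm_im IHr // (negPf i0r).
rewrite push_perm_notin ?IHr //; apply/codomP => -[j' /f_inj[ii0' _]].
by rewrite ii0' eqxx in ii0.
Qed.

Lemma odd_perm_fiberwise (Q : I -> {perm J}) (p : {perm T}) :
  (forall i j, p (f i j) = f i (Q i j)) ->
  odd_perm p = \big[addb/false]_i odd_perm (Q i).
Proof.
move=> pE; have -> : p = (\prod_i push_perm (@fi_inj i) (Q i))%g.
  apply/permP => x; have [i [j ->]] := f_surj x.
  by rewrite pE prod_push_permE ?index_enum_uniq // mem_index_enum.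
rewrite (big_morph _ (@odd_permM _) (@odd_perm1 _)).
by apply: eq_bigr => i _; rewrite odd_push_perm.
Qed.

End SignGlue.

(** * Determinants over arbitrary finite index types *)

Section FunDet.
Variable F : comNzRingType.

Lemma sum_injective_support (I J : finType) (h : I -> J) (G : J -> F) :
    injective h -> (forall j, j \notin codom h -> G j = 0) ->
  \sum_j G j = \sum_i G (h i).
Proof.
move=> h_inj G0; rewrite (bigID [in codom h]) /= [X in _ + X]big1 // addr0.
rewrite -(big_imset G (in2W h_inj)) /=; apply: eq_bigl => j.
by apply/codomP/imsetP => [[i ->]|[i _ ->]]; exists i.
Qed.

(** Leibniz's formula uses no order on the indices, so ['I_n * 'I_k] can index rows and columns
    without an enumeration. *)
Definition fdet (T : finType) (A : T -> T -> F) : F :=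
  \sum_(p : {perm T}) (-1) ^+ odd_perm p * \prod_x A x (p x).

Lemma det_fdet n (A : 'M[F]_n) : \det A = fdet (fun i j => A i j).
Proof. by []. Qed.

Lemma eq_fdet (T : finType) (A B : T -> T -> F) :
  (forall x y, A x y = B x y) -> fdet A = fdet B.
Proof.
move=> AB; apply: eq_bigr => p _; congr (_ * _).
by apply: eq_bigr => x _; rewrite AB.
Qed.

Lemma fdet_perm_col (T : finType) (A : T -> T -> F) (s : {perm T}) :
  fdet (fun x y => A x (s y)) = (-1) ^+ odd_perm s * fdet A.
Proof.
rewrite /fdet big_distrr [RHS](reindex_inj (mulIg s)) /=.
apply: eq_bigr => p _; rewrite odd_permM mulrA -signr_addb addbCA addbb addbF.
by congr (_ * _); apply: eq_bigr => x _; rewrite permM.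
Qed.

Lemma fdet_conj (T : finType) (A : T -> T -> F) (s : {perm T}) :
  fdet (fun x y => A (s x) (s y)) = fdet A.
Proof.
rewrite /fdet [RHS](reindex_inj (conjg_inj s)) /=.
apply: eq_bigr => p _; rewrite odd_permJ; congr (_ * _).
rewrite [RHS](reindex_inj (@perm_inj _ s)) /=.
by apply: eq_bigr => x _; rewrite permJ.
Qed.

(** A permutation with a nonzero term must fix every identity row, hence is pushed from [S]. This
    puts minors of different sizes on one index type. *)
Lemma fdet_pad (S T : finType) (f : S -> T) (A : S -> S -> F) (B : T -> T -> F) :
    injective f ->
    (forall a b, B (f a) (f b) = A a b) ->
    (forall x y, x \notin codom f -> B x y = (x == y)%:R) ->
  fdet B = fdet A.
Proof.
move=> f_inj BA B1; rewrite /fdet.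
rewrite (sum_injective_support (@push_perm_inj _ _ _ f_inj)) => [|p pP].
  apply: eq_bigr => q _; rewrite odd_push_perm; congr (_ * _).
  rewrite (bigID [in codom f]) /= [X in _ * X]big1 => [|x xf]; last first.
    by rewrite B1 // push_perm_notin // eqxx.
  rewrite mulr1 -[RHS](eq_bigr _ (fun a _ => BA a (q a))).
  rewrite -(eq_bigr _ (fun a _ => congr1 (B (f a)) (push_perm_im f_inj q a))).
  rewrite -(big_imset (fun x => B x (push_perm f_inj q x)) (in2W f_inj)) /=.
  apply: eq_bigl => x.
  by apply/codomP/imsetP => [[a ->]|[a _ ->]]; exists a.
have [x xf xp] : exists2 x, x \notin codom f & p x != x.
  apply/exists_inP; apply: contraNT pP => /exists_inPn pfix.
  have [q ->] := push_perm_surj f_inj (fun x xf => eqP (negPn (pfix x xf))).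
  exact: codom_f.
by rewrite (bigD1 x) //= B1 // eq_sym (negPf xp) mul0r mulr0.
Qed.

(** Expanding the product of determinants gives one term per family [Q] of permutations of the
    fibres; gluing [Q] gives exactly the permutations that can contribute to [fdet D]. *)
Lemma fdet_fiberwise (I J T : finType) (f : I -> J -> T)
    (B : I -> J -> J -> F) (D : T -> T -> F) :
    (forall i i' j j', f i j = f i' j' -> i = i' /\ j = j') ->
    (forall x, exists i j, x = f i j) ->
    (forall i i' j j', D (f i j) (f i' j') = if i == i' then B i j j' else 0) ->
  fdet D = \prod_i fdet (B i).
Proof.
move=> f_inj f_surj DE.
have f_bij : bijective (fun u : I * J => f u.1 u.2).
  apply: inj_card_bij => [[i j] [i' j'] /= /f_inj[-> ->] //|].
  rewrite -(card_codom (f := fun u : I * J => f u.1 u.2)); last first.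
    by move=> [i j] [i' j'] /= /f_inj[-> ->].
  apply/subset_leq_card/subsetP => x _; have [i [j ->]] := f_surj x.
  exact: (codom_f (fun u : I * J => f u.1 u.2) (i, j)).
(* Boolean quantifiers allow [xchoose] to select the glued permutation. *)
have glueK (Q : {ffun I -> {perm J}}) :
    exists p : {perm T}, [forall i, forall j, p (f i j) == f i (Q i j)].
  have [f' fK f'K] := f_bij.
  have h_inj : injective (fun x => f (f' x).1 (Q (f' x).1 (f' x).2)).
    move=> x y /f_inj[xy1]; rewrite xy1 => /perm_inj xy2.
    by rewrite -[x]f'K -[y]f'K xy1 xy2.
  exists (perm h_inj); apply/forallP => i; apply/forallP => j.
  by rewrite permE (fK (i, j)).
pose glue Q := xchoose (glueK Q).
have glueE Q i j : glue Q (f i j) = f i (Q i j).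
  by apply/eqP; apply: (forallP (forallP (xchooseP (glueK Q)) i)).
have glue_inj : injective glue.
  move=> Q Q' eqQ; apply/ffunP => i; apply/permP => j.
  by have := glueE Q i j; rewrite eqQ glueE => /f_inj[].
rewrite /fdet bigA_distr_bigA /= (sum_injective_support glue_inj) => [|p pP].
  apply: eq_bigr => Q _; rewrite (odd_perm_fiberwise f_inj f_surj (glueE Q)).
  rewrite [RHS]big_split; congr (_ * _).
    by rewrite (big_morph (fun b : bool => (-1) ^+ b : F) (@signr_addb F) erefl).
  rewrite (reindex _ (onW_bij _ f_bij)) pair_bigA /=.
  by apply: eq_bigr => -[i j] _ /=; rewrite glueE DE eqxx.
(* A permutation that is not glued sends some [f i j] out of its fibre, where [D] has a zero entry;
   otherwise its restrictions to the fibres would glue back to it. *)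
have [i [j pij]] : exists i, exists j, [forall j', p (f i j) != f i j'].
  suff /existsP[i /existsP[j pij]] :
      [exists i, exists j, forall j', p (f i j) != f i j'] by exists i, j.
  apply: contraNT pP => /existsPn pfib.
  have pf i j : exists j', p (f i j) == f i j'.
    by have /existsPn/(_ j)/forallPn[j' /negPn] := pfib i; exists j'.
  have Q_inj i : injective (fun j => xchoose (pf i j)).
    move=> j j' eqj; have := eqP (xchooseP (pf i j)).
    by rewrite eqj -(eqP (xchooseP (pf i j'))) => /perm_inj/f_inj[].
  have -> : p = glue [ffun i => perm (@Q_inj i)]; last exact: codom_f.
  apply/permP => x; have [i [j ->]] := f_surj x.
  by rewrite glueE ffunE permE; apply/eqP/(xchooseP (pf i j)).
have [i' [j' pE]] := f_surj (p (f i j)).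
rewrite (bigD1 (f i j)) //= pE DE; case: eqP => [ii'|_]; last first.
  by rewrite mul0r mulr0.
by have /forallP/(_ j') := pij; rewrite pE ii' eqxx.
Qed.
End FunDet.

(** * Signs of restrictions to unions of cycles *)

Section RestrSign.
Variables (I : finType) (s : {perm I}).

Lemma restr_perm_stableE (S : {set I}) i :
  (forall j, (s j \in S) = (j \in S)) ->
  restr_perm S s i = if i \in S then s i else i.
Proof.
move=> sS; have sN : s \in 'N(S | 'P)%g.
  by apply/astabsP => j; rewrite /= apermE.
case: ifP => iS; first exact: restr_permE.
by apply: out_perm (restr_perm_on S s) _; rewrite iS.
Qed.

Lemma restr_perm0 : restr_perm set0 s = 1%g.
Proof.
by apply/permP => i; rewrite restr_perm_stableE ?perm1 ?inE // => j; rewrite !inE.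
Qed.

Lemma restr_permU (A B : {set I}) :
    (forall j, (s j \in A) = (j \in A)) -> (forall j, (s j \in B) = (j \in B)) ->
    [disjoint A & B] ->
  restr_perm (A :|: B) s = (restr_perm A s * restr_perm B s)%g.
Proof.
move=> sA sB dAB; apply/permP => i.
rewrite permM !restr_perm_stableE // => [|j]; last by rewrite !inE sA sB.
rewrite inE; have [iA|//] := boolP (i \in A).
by rewrite sB (disjointFr dAB).
Qed.

Variable m : I -> nat.
Hypothesis m_s : forall i, m (s i) = m i.

Lemma odd_restr_permU (P Q R : pred nat) :
    (forall x, R x = P x || Q x) -> (forall x, P x -> ~~ Q x) ->
  odd_perm (restr_perm [set i | R (m i)] s) =
    odd_perm (restr_perm [set i | P (m i)] s)
      (+) odd_perm (restr_perm [set i | Q (m i)] s).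
Proof.
move=> RPQ PQ; rewrite -odd_permM -restr_permU.
- by congr (odd_perm (restr_perm _ _)); apply/setP => i; rewrite !inE RPQ.
- by move=> j; rewrite !inE m_s.
- by move=> j; rewrite !inE m_s.
by rewrite disjoints_subset; apply/subsetP => i; rewrite !inE => /PQ.
Qed.

Lemma odd_restr_perm_pred0 (P : pred nat) : (forall x, ~~ P x) ->
  odd_perm (restr_perm [set i | P (m i)] s) = false.
Proof.
move=> P0; have -> : [set i | P (m i)] = set0.
  by apply/setP => i; rewrite !inE (negPf (P0 _)).
by rewrite restr_perm0 odd_perm1.
Qed.

(** The cap [m i <= N] allows induction on [N]: passing to [N.+1] only adds the slots with
    [m i = N.+1], which lie in all [N.+1] sets on the left. *)
Lemma odd_restr_perm_upto N :
  \big[addb/false]_(u < N) odd_perm (restr_perm [set i | (u < m i <= N)%N] s)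
    = odd_perm (restr_perm [set i | odd (m i) && (m i <= N)%N] s).
Proof.
elim: N => [|N IHN].
  rewrite big_ord0 (@odd_restr_perm_pred0 (fun x => odd x && (x <= 0)%N)) //.
  by case=> // x; rewrite andbF.
set e := odd_perm (restr_perm [set i | m i == N.+1] s).
transitivity (\big[addb/false]_(u < N.+1)
   (odd_perm (restr_perm [set i | (u < m i <= N)%N] s) (+) e)).
  apply: eq_bigr => u _.
  apply: (@odd_restr_permU (fun x => (u < x <= N)%N) (fun x => x == N.+1)
    (fun x => (u < x <= N.+1)%N)).
    move=> x; rewrite (leq_eqVlt x N.+1) ltnS andb_orr orbC.
    by case: eqP => [->|]; rewrite ?andbT ?andbF ?ltn_ord.
  by move=> x /andP[_ xN]; rewrite neq_ltn ltnS xN.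
rewrite big_split big_ord_recr /= IHN big_const_ord.
rewrite (@odd_restr_perm_pred0 (fun x => (N < x <= N)%N)) => [|x]; last first.
  by rewrite ltnNge andNb.
rewrite addbF (@odd_restr_permU (fun x => odd x && (x <= N)%N)
  (fun x => odd N.+1 && (x == N.+1)) (fun x => odd x && (x <= N.+1)%N)).
- congr (_ (+) _).
  (* The sign [e] of the new level is counted [N.+1] times, hence survives only if [N.+1] is odd. *)
  have -> : iter N.+1 (addb e) false = odd N.+1 && e.
    by elim: N.+1 => //= p ->; case: (e) (odd p) => [] [].
  case: (boolP (odd N.+1)) => oN /=; first by congr (odd_perm (restr_perm _ _)).
  by rewrite (@odd_restr_perm_pred0 xpred0).
- move=> x; rewrite (leq_eqVlt x N.+1) ltnS andb_orr orbC.
  by case: (x =P N.+1) => [->|]; rewrite ?andbF.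
by move=> x /andP[_ xN]; rewrite negb_and [_ != _]neq_ltn ltnS xN orbT.
Qed.

(* A cycle of s on which m equals v occurs in exactly v of the sets on the left. *)
Lemma odd_restr_perm_levels N : (forall i, m i <= N)%N ->
  \big[addb/false]_(u < N) odd_perm (restr_perm [set i | (u < m i)%N] s)
    = odd_perm (restr_perm [set i | odd (m i)] s).
Proof.
move=> mN; have -> : [set i | odd (m i)] = [set i | odd (m i) && (m i <= N)%N].
  by apply/setP => i; rewrite !inE mN andbT.
rewrite -odd_restr_perm_upto; apply: eq_bigr => u _.
by congr (odd_perm (restr_perm _ _)); apply/setP => i; rewrite !inE mN andbT.
Qed.

End RestrSign.

(** * Moving a subset to an initial segment *)

Section SetPerm.
Variables (k : nat) (X : {set 'I_k}).

(** Lists [X] in increasing order, then its complement. The list has length [k], so the default [u]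
    of [nth] is never returned; it only supplies an element of ['I_k]. *)
Let rank_fun (u : 'I_k) := nth u (enum X ++ enum (~: X)) u.

Let size_rank : size (enum X ++ enum (~: X)) = k.
Proof. by rewrite size_cat -!cardE cardsC card_ord. Qed.

Lemma set_perm_subproof : injective rank_fun.
Proof.
move=> u v; rewrite /rank_fun (set_nth_default u v) ?size_rank //.
move/eqP; rewrite nth_uniq ?size_rank // => [/eqP/val_inj //|].
rewrite cat_uniq !enum_uniq andbT /=; apply/hasPn => x.
by rewrite !mem_enum inE.
Qed.

Definition set_perm : 'S_k := perm set_perm_subproof.

Lemma set_permE (u : 'I_k) (uX : (u < #|X|)%N) :
  set_perm u = enum_val (Ordinal uX).
Proof.
rewrite permE /rank_fun nth_cat -cardE uX.
by rewrite (enum_val_nth u).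
Qed.

Lemma mem_set_perm (u : 'I_k) : (set_perm u \in X) = (u < #|X|)%N.
Proof.
have [uX|Xu] := ltnP u #|X|; first by rewrite set_permE enum_valP.
rewrite permE /rank_fun nth_cat -cardE ltnNge Xu /=.
have : nth u (enum (~: X)) (u - #|X|) \in ~: X.
  rewrite -mem_enum mem_nth // -cardE ltn_subLR // cardsC card_ord.
  exact: ltn_ord.
by rewrite inE => /negPf.
Qed.

End SetPerm.

(** * Minors as padded determinants *)

Section Minors.
Variable F : comNzRingType.

Lemma minorE (T : finType) (A : T -> T -> F) (Y X : {set T}) (e : #|Y| = #|X|) :
  minor A Y X = fdet (fun a b : 'I_#|X| =>
    A (enum_val (cast_ord (esym e) a)) (enum_val b)).
Proof.
rewrite /minor; case: eqP => // e'; rewrite det_fdet; apply: eq_fdet => a b.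
by rewrite mxE (eq_irrelevance e' e).
Qed.

Lemma minor_neq (T : finType) (A : T -> T -> F) (Y X : {set T}) :
  #|Y| != #|X| -> minor A Y X = 0.
Proof. by rewrite /minor => /eqP YX; case: eqP => // e; case: YX. Qed.

Lemma minor_principal (T : finType) (A : T -> T -> F) (X : {set T}) :
  minor A X X
    = fdet (fun x y => if (x \in X) && (y \in X) then A x y else (x == y)%:R).
Proof.
rewrite (minorE A (erefl #|X|)); apply/esym.
apply: (fdet_pad enum_val_inj) => [a b|x y xX].
  by rewrite !enum_valP cast_ord_id.
case: ifP => // /andP[xX' _]; case/negP: xX; apply/codomP.
by exists (enum_rank_in xX' x); rewrite enum_rankK_in.
Qed.

(** Rows [Y] and columns [X] both become the initial segment of length [#|X|], and the rest is
    padded by the identity. No sign appears because [set_perm] is increasing on that segment. *)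
Lemma minor_set_perm k (A : 'I_k -> 'I_k -> F) (Y X : {set 'I_k}) :
    #|Y| = #|X| ->
  minor A Y X = fdet (fun u v : 'I_k =>
    if (u < #|X|)%N && (v < #|X|)%N then A (set_perm Y u) (set_perm X v)
    else (u == v)%:R).
Proof.
move=> e; rewrite (minorE A e); apply/esym.
have Xk : (#|X| <= k)%N by rewrite -[k in leqRHS]card_ord max_card.
have f_inj : injective (widen_ord Xk) by move=> a b /(congr1 val) ab; apply: val_inj.
apply: (fdet_pad f_inj) => [a b|x y xX].
  have wX (c : 'I_#|X|) : (widen_ord Xk c < #|X|)%N by exact: (ltn_ord c).
  have aY : (widen_ord Xk a < #|Y|)%N by rewrite e wX.
  have bX := wX b; rewrite !wX /= (set_permE aY) (set_permE bX).
  by congr (A _ _); congr enum_val; apply: val_inj.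
case: ifP => // /andP[xX' _]; case/negP: xX; apply/codomP.
by exists (Ordinal xX'); apply: val_inj.
Qed.

End Minors.

(** * Principal minors of a wreath product element *)

Section WreathMinor.
Variables (F : comNzRingType) (k n : nat) (g : 'I_n -> 'M[F]_k) (s : 'S_n).
Variable a : 'I_n -> {set 'I_k}.

Let X : {set 'I_n * 'I_k} := [set x | x.2 \in a x.1].
Let m i := #|a i|.
Let pairT := ('I_n * 'I_k)%type.

(** A nonzero Leibniz term [p] maps the part of [X] in slot [j] injectively into the part in slot
    [s^-1 j], so [m] cannot decrease along [s^-1], hence is constant on cycles. *)
Lemma minor_wreath_neq i : m (s i) != m i -> minor (wreathMx g s) X X = 0.
Proof.
move=> mi; rewrite minor_principal; set W := fun x y => _.
apply: big1 => p _.
have [/forallP Wp|] := boolP [forall x, W x (p x) != 0]; last first.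
  by move=> /forallPn[x /negPn/eqP Wx]; rewrite (bigD1 x) //= Wx mul0r mulr0.
have pX j c : c \in a j ->
    (p (j, c)).1 = (s^-1)%g j /\ (p (j, c)).2 \in a ((s^-1)%g j).
  move=> cj; have xX : (j, c) \in X by rewrite inE.
  have := Wp (j, c); rewrite /W xX /=; case: ifP => [pxX|pxX].
    rewrite /wreathMx /=; case: (j =P _) => [jE _|_]; last by rewrite eqxx.
    have p1 : (p (j, c)).1 = (s^-1)%g j by apply: (canRL (permK s)); rewrite -jE.
    by rewrite -p1; split=> //; move: pxX; rewrite inE.
  by case: ((j, c) =P _) => [xp|_]; rewrite ?eqxx //; rewrite -xp xX in pxX.
have le_m j : (m j <= m ((s^-1)%g j))%N.
  rewrite -[m j](@card_in_imset _ _ (fun c => (p (j, c)).2)) => [|c d cj dj /= eq2].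
    apply/subset_leq_card/subsetP => _ /imsetP[c cj ->].
    by have [] := pX _ _ cj.
  have [p1 _] := pX _ _ cj; have [p1' _] := pX _ _ dj.
  have : p (j, c) = p (j, d).
    by rewrite [LHS]surjective_pairing [RHS]surjective_pairing p1 p1' eq2.
  by move/perm_inj => [].
(* Both sides of [le_m] have the same sum over [j], by reindexing along [s]; so each inequality is
   an equality. *)
have [_] := leqif_sum (fun j (_ : true) => leqif_eq (le_m j)).
rewrite [X in _ == X](reindex_inj (@perm_inj _ s)) /=.
under [X in _ == X]eq_bigr do rewrite permK.
rewrite eqxx => /esym/forallP/(_ (s i)); rewrite permK /= => /eqP mE.
by rewrite mE eqxx in mi.
Qed.

Hypothesis m_s : forall i, m (s i) = m i.

(** Reorders each slot so that [a i] occupies its first [m i] coordinates. *)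
Let rho_fun (x : pairT) : pairT := (x.1, set_perm (a x.1) x.2).
Let rho_inj : injective rho_fun.
Proof. by move=> [i u] [j v] [-> /perm_inj ->]. Qed.

(** On the layer of second coordinate [u], only slots with [u < m i] are moved by [s]; padded
    coordinates stay fixed. *)
Let sigma_fun (x : pairT) : pairT :=
  (restr_perm [set i | x.2 < m i]%N s x.1, x.2).
Let sigma_inj : injective sigma_fun.
Proof. by move=> [i u] [j v] /= [ij uv]; move: ij; rewrite uv => /perm_inj ->. Qed.

Let sigma := perm sigma_inj.

Let sigmaE i u : sigma (i, u) = (if (u < m i)%N then s i else i, u).
Proof.
by rewrite permE /sigma_fun /= restr_perm_stableE ?inE // => j; rewrite !inE m_s.
Qed.

(** [sigma] preserves each layer of constant second coordinate, so its sign is the product over the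
    layers. *)
Let odd_sigma : odd_perm sigma = odd_perm (restr_perm [set i | odd (m i)] s).
Proof.
have mk i : (m i <= k)%N by rewrite -[k in leqRHS]card_ord max_card.
rewrite -(odd_restr_perm_levels m_s mk).
apply: (@odd_perm_fiberwise _ _ pairT (fun (u : 'I_k) (i : 'I_n) => (i, u))
  _ _ (fun u : 'I_k => restr_perm [set i | u < m i]%N s)).
- by move=> u u' i i' [-> ->].
- by move=> [i u]; exists u, i.
by move=> u i; rewrite permE.
Qed.

Lemma minor_wreath_eq :
  minor (wreathMx g s) X X =
    (-1) ^+ odd_perm (restr_perm [set i | odd (m i)] s) *
    \prod_i minor (fun r c => g i r c) (a i) (a ((s^-1)%g i)).
Proof.
have m_sV i : m ((s^-1)%g i) = m i by rewrite -[in RHS](permKV s i) m_s.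
(* [B i] is the padded form of the minor of [g i] given by [minor_set_perm]; [D] is block diagonal
   by slots, and precomposing its columns with [sigma] gives the matrix conjugated by [rho]. *)
pose B i (u v : 'I_k) : F := if (u < m i)%N && (v < m i)%N
  then g i (set_perm (a i) u) (set_perm (a ((s^-1)%g i)) v) else (u == v)%:R.
pose D (x y : pairT) := if x.1 == y.1 then B x.1 x.2 y.2 else 0.
rewrite minor_principal -(fdet_conj _ (perm rho_inj)).
rewrite (@eq_fdet _ _ _ (fun x y => D x (sigma y))) => [|[i u] [j v]].
  rewrite fdet_perm_col odd_sigma; congr (_ * _).
  rewrite (@fdet_fiberwise _ _ _ _ pair B) => [||[i u]|//]; first last.
  - by exists i, u.
  - by move=> i j u v [-> ->].
  apply: eq_bigr => i _; rewrite minor_set_perm; last exact: esym (m_sV i).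
  by apply: eq_fdet => u v; rewrite /B -/(m _) m_sV.
rewrite sigmaE !permE /rho_fun /D /B /wreathMx !inE /= !mem_set_perm -!/(m _).
have -> : ((i, set_perm (a i) u) == (j, set_perm (a j) v)) = (i == j) && (u == v).
  exact: (inj_eq rho_inj (i, u) (j, v)).
have [vj|jv] := ltnP v (m j).
  (* A padded row against a column of [X]: the padding entry is off the diagonal, hence zero. *)
  have uv0 : (m j <= u)%N -> (u == v) = false.
    by move=> ju; apply: contraTF vj => /eqP <-; rewrite -leqNgt.
  have [->|ij] := eqVneq i (s j).
    rewrite m_s vj !andbT permK; case: ltnP => // ju.
    by rewrite uv0 // andbF.
  rewrite andbT; case: ltnP => // iu.
  by case: eqVneq => [eij|//]; rewrite uv0 // -eij.
by rewrite andbF; case: (i =P j) => [->|//]; rewrite [(v < m j)%N]ltnNge jv andbF.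
Qed.

End WreathMinor.

(** * The exterior algebra side as a sum over families *)

Section LambdaSum.
Variable F : comNzRingType.

(** The free bound [N] serves subsets of the basis on the left side and subsets of the [n] slots on
    the right side. *)
Lemma sum_sets_by_card (T : finType) (N : nat) (f : {set T} -> F) :
  (#|T| <= N)%N ->
  \sum_(i < N.+1) \sum_(X : {set T} | #|X| == i) f X = \sum_X f X.
Proof.
move=> TN; rewrite [RHS](partition_big
  (fun X : {set T} => inord #|X| : 'I_N.+1) xpredT) //=.
apply: eq_bigr => i _; apply: eq_bigl => X.
by rewrite -val_eqE /= inordK // ltnS (leq_trans (max_card _)).
Qed.

Lemma lambdaTr_sum (T : finType) (A : T -> T -> F) :
  lambdaTr A = \sum_(X : {set T}) (-1) ^+ #|X| * minor A X X.
Proof.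
rewrite -(sum_sets_by_card _ (leqnn #|T|)); apply: eq_bigr => i _.
by rewrite /trExt big_distrr; apply: eq_bigr => X /eqP ->.
Qed.

Variables (k n : nat) (g : 'I_n -> 'M[F]_k) (s : 'S_n).

Definition odd_slots (a : 'I_n -> {set 'I_k}) : {set 'I_n} :=
  [set i | odd #|a i|].

(** The diagonal coefficient of [(g, s)] at the tensor [e_a], before any sign. *)
Definition minor_prod (a : 'I_n -> {set 'I_k}) : F :=
  \prod_i minor (fun r c => g i r c) (a i) (a ((s^-1)%g i)).

Lemma minor_prod_neq (a : 'I_n -> {set 'I_k}) i :
  #|a (s i)| != #|a i| -> minor_prod a = 0.
Proof.
move=> ai; rewrite /minor_prod (bigD1 (s i)) //= minor_neq ?mul0r //.
by rewrite permK.
Qed.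

(** If [#|a i|] is not constant on the cycles of [s], both sides vanish; otherwise this is
    [minor_wreath_eq]. *)
Lemma minor_wreath (a : 'I_n -> {set 'I_k}) :
  let X := [set x : 'I_n * 'I_k | x.2 \in a x.1] in
  minor (wreathMx g s) X X =
    (-1) ^+ odd_perm (restr_perm (odd_slots a) s) * minor_prod a.
Proof.
have [/forallP a_s|/forallPn[i ai]] := boolP [forall i, #|a (s i)| == #|a i|].
  exact: (minor_wreath_eq g (fun i => eqP (a_s i))).
by move=> X; rewrite (minor_prod_neq ai) mulr0; apply: minor_wreath_neq ai.
Qed.

Lemma sign_card_family (a : 'I_n -> {set 'I_k}) :
  (-1) ^+ #|[set x : 'I_n * 'I_k | x.2 \in a x.1]|
    = (-1) ^+ #|odd_slots a| :> F.
Proof.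
have -> : #|[set x : 'I_n * 'I_k | x.2 \in a x.1]| = (\sum_i #|a i|)%N.
  rewrite -sum1dep_card -(pair_big_dep xpredT (fun i c => c \in a i)
    (fun _ _ => 1%N)) /=.
  by apply: eq_bigr => i _; rewrite sum1_card.
rewrite -sum1dep_card !(big_morph _ (exprD _) (expr0 _)) [RHS]big_mkcond /=.
by apply: eq_bigr => i _; rewrite -signr_odd; case: odd.
Qed.

Lemma lambdaCkn_sum : lambdaCkn g s =
  \sum_(a : {ffun 'I_n -> {set 'I_k}}) (-1) ^+ #|odd_slots a| *
    ((-1) ^+ odd_perm (restr_perm (odd_slots a) s) * minor_prod a).
Proof.
rewrite /lambdaCkn lambdaTr_sum.
pose toX (a : {ffun 'I_n -> {set 'I_k}}) := [set x : 'I_n * 'I_k | x.2 \in a x.1].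
have toX_bij : bijective toX.
  exists (fun X : {set 'I_n * 'I_k} => [ffun i => [set c | (i, c) \in X]]).
    by move=> a; apply/ffunP => i; rewrite ffunE; apply/setP => c; rewrite !inE.
  by move=> X; apply/setP => -[i c]; rewrite inE ffunE inE.
rewrite (reindex _ (onW_bij _ toX_bij)) /=; apply: eq_bigr => a _.
by rewrite minor_wreath sign_card_family.
Qed.

End LambdaSum.

(** * Counting permutations with a prescribed image of a set *)

Section PermCount.
Variable n : nat.
Implicit Types L M : {set 'I_n}.

Lemma card_lastBlock m : (m <= n)%N -> #|lastBlock n m| = m.
Proof.
move=> mn; rewrite -sum1dep_card.
rewrite -(big_geq_mkord _ _ xpredT (fun=> 1%N)) sum_nat_const_nat muln1.
by rewrite subKn.
Qed.

(** The two sets are matched through their common initial segment. *)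
Lemma exists_perm_imset M M' : #|M| = #|M'| -> exists t : 'S_n, t @: M = M'.
Proof.
move=> MM'; pose t := ((set_perm M)^-1 * set_perm M')%g.
exists t; apply/setP => x; rewrite -[x](permKV t); move: ((t^-1)%g x) => y.
rewrite mem_imset; last exact: perm_inj.
by rewrite permM mem_set_perm -MM' -mem_set_perm permKV.
Qed.

(** Right translation shows that the count is the same for all targets of size [#|L|]. There are
    ['C(n, #|L|)] of them sharing the [n!] permutations. *)
Lemma card_perm_imset L M : #|L| = #|M| ->
  #|[set t : 'S_n | t @: L == M]| = (#|L|`! * (n - #|L|)`!)%N.
Proof.
pose N M := #|[set t : 'S_n | t @: L == M]|.
have le_N M1 M2 : #|M1| = #|M2| -> (N M1 <= N M2)%N.
  case/exists_perm_imset => t0 t0M.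
  rewrite /N -(card_imset _ (mulIg t0)); apply/subset_leq_card/subsetP => t'.
  case/imsetP => t; rewrite inE => /eqP tL ->; rewrite inE -t0M -tL -imset_comp.
  by apply/eqP/eq_imset => i; rewrite permM.
move=> LM; rewrite -/(N M).
have Ln : (#|L| <= n)%N by rewrite -[n in leqRHS]card_ord max_card.
have Cgt0 : (0 < 'C(n, #|L|))%N by rewrite bin_gt0.
apply/eqP; rewrite -(eqn_pmul2l Cgt0) bin_fact // -card_Sn.
have <- : #|[set A : {set 'I_n} | #|A| == #|L|]| = 'C(n, #|L|).
  by rewrite card_draws card_ord.
rewrite -sum_nat_const -[X in _ == X]sum1_card.
rewrite (partition_big (fun t : 'S_n => t @: L)
  [in [set A : {set 'I_n} | #|A| == #|L|]]) /=; last first.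
  by move=> t _; rewrite inE card_imset //; apply: perm_inj.
apply/eqP/eq_bigr => M'; rewrite inE => /eqP M'L.
have -> : N M = N M' by apply/eqP; rewrite eqn_leq !le_N ?M'L.
by rewrite /N -sum1_card; apply: eq_bigl => t; rewrite !inE.
Qed.

End PermCount.

(** * The induced character side as a sum over families *)

Section EtaSum.
Variables (F : numFieldType) (k n : nat) (g : 'I_n -> 'M[F]_k) (s : 'S_n).
Implicit Types (L M : {set 'I_n}) (t : 'S_n).

Definition stable_on M := [forall i, (s i \in M) == (i \in M)].

(** The common contribution of all [t] that carry the last block onto a stable [M]. *)
Definition block_term M : F :=
  (-1) ^+ odd_perm (restr_perm M s) *
  \sum_(a : {ffun 'I_n -> {set 'I_k}} | odd_slots a == M) minor_prod g s a.

Let mem_im t L i : (t i \in t @: L) = (i \in L).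
Proof. by rewrite mem_imset //; apply: perm_inj. Qed.

Let mem_imV t L i : ((t^-1)%g i \in L) = (i \in t @: L).
Proof. by rewrite -[in RHS](permKV t i) mem_im. Qed.

Lemma inYoung_conj m t :
  inYoung m (t * s * t^-1)%g = stable_on (t @: lastBlock n m).
Proof.
apply/forallP/forallP => st i; last first.
  by rewrite !permM mem_imV -(mem_im t (lastBlock n m) i) st.
by have := st ((t^-1)%g i); rewrite !permM permKV !mem_imV.
Qed.

(** Restriction to a stable set commutes with conjugation, which preserves signs. *)
Lemma odd_restr_perm_conj L t : stable_on (t @: L) ->
  odd_perm (restr_perm L (t * s * t^-1)%g) = odd_perm (restr_perm (t @: L) s).
Proof.
move=> /forallP st.
have -> : restr_perm L (t * s * t^-1)%g = (t * restr_perm (t @: L) s * t^-1)%g.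
  apply/permP => i; rewrite !permM restr_perm_stableE => [|j]; last first.
    by rewrite !permM mem_imV (eqP (st _)) mem_im.
  rewrite restr_perm_stableE => [|j]; last exact: eqP (st j).
  by rewrite mem_im !permM; case: ifP => // _; rewrite permK.
by rewrite !odd_permM odd_permV addbAC addbb.
Qed.

(** Relabelling the slots of [a] by [t] turns the parity condition of [tensTr] into
    [odd_slots a = t @: lastBlock n m]. *)
Lemma etaEpsTr_conj m t : stable_on (t @: lastBlock n m) ->
  etaEpsTr m (fun i => g (t i)) (t * s * t^-1)%g
    = block_term (t @: lastBlock n m).
Proof.
move=> st; rewrite /etaEpsTr /block_term odd_restr_perm_conj //; congr (_ * _).
pose h (a : {ffun 'I_n -> {set 'I_k}}) := [ffun i => a (t i)].
have h_bij : bijective h.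
  exists (fun a : {ffun 'I_n -> {set 'I_k}} => [ffun i => a ((t^-1)%g i)]) => a;
    by apply/ffunP => i; rewrite !ffunE ?permKV ?permK.
rewrite /tensTr (reindex _ (onW_bij _ h_bij)) /=; apply: eq_big => [a|a _].
  apply/forallP/eqP => [aM|aM i].
    apply/setP => i; rewrite inE -mem_imV.
    by have := eqP (aM ((t^-1)%g i)); rewrite ffunE permKV.
  by rewrite ffunE -(mem_im t _ i) -aM inE.
rewrite /minor_prod [RHS](reindex_inj (@perm_inj _ t)) /=.
apply: eq_bigr => i _; rewrite /extmx !ffunE.
by rewrite !invMg invgK !permM permKV.
Qed.

(** Group the [t] by the image of the last block: each class has [m! (n-m)!] elements, which cancels
    the prefactor since [F] has characteristic zero. *)
Lemma indEtaEps_sum m : (m <= n)%N ->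
  indEtaEps m g s =
    \sum_(M : {set 'I_n} | #|M| == m) if stable_on M then block_term M else 0.
Proof.
move=> mn; rewrite /indEtaEps; set L := lastBlock n m.
have cL : #|L| = m by apply: card_lastBlock.
rewrite (eq_bigl (fun t => stable_on (t @: L))) => [|t]; last exact: inYoung_conj.
rewrite (eq_bigr (fun t => block_term (t @: L))) => [|t]; last exact: etaEpsTr_conj.
rewrite big_mkcond (partition_big (fun t : 'S_n => t @: L)
  (fun M : {set 'I_n} => #|M| == m)) /=; last first.
  by move=> t _; rewrite card_imset ?cL //; apply: perm_inj.
rewrite big_distrr; apply: eq_bigr => M /eqP cM /=.
rewrite (eq_bigr (fun=> if stable_on M then block_term M else 0)); last first.
  by move=> t /eqP->.
rewrite sumr_const -cardsE card_perm_imset ?cL ?cM // mulnC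
  -[X in _ * X]mulr_natl mulrA.
by rewrite mulVf ?mul1r // Num.Theory.pnatr_eq0 muln_eq0 !gtn_eqF ?fact_gt0.
Qed.

Lemma etaLambda_sum : etaLambda g s =
  \sum_(a : {ffun 'I_n -> {set 'I_k}}) (-1) ^+ #|odd_slots a| *
    ((-1) ^+ odd_perm (restr_perm (odd_slots a) s) * minor_prod g s a).
Proof.
rewrite [RHS](partition_big
  (fun a : {ffun 'I_n -> {set 'I_k}} => odd_slots a) xpredT) //=.
rewrite -(@sum_sets_by_card _ _ n) ?card_ord //; apply: eq_bigr => m _.
rewrite indEtaEps_sum; last by rewrite -ltnS.
rewrite big_distrr; apply: eq_bigr => M /eqP <- /=.
rewrite [RHS](eq_bigr (fun a : {ffun 'I_n -> {set 'I_k}} => (-1) ^+ #|M| *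
    ((-1) ^+ odd_perm (restr_perm M s) * minor_prod g s a))); last first.
  by move=> a /eqP->.
(* An unstable [M] is absent from the induced character. Here its terms vanish too: if
   [odd_slots a = M], then [#|a i|] changes along [s] and [minor_prod] is zero. *)
rewrite -!big_distrr; case: ifP => //= /negbT/forallPn[i si].
rewrite big1 ?mulr0 // => a /eqP aM; apply: (@minor_prod_neq _ _ _ _ _ _ i).
by apply: contraNneq si => ai; rewrite -aM !inE ai.
Qed.

End EtaSum.

Theorem mainTheorem7 (R : realType) (k n : nat) (Gamma : {pred 'M[Cplx R]_k})
    (Gamma_GL : forall A, A \in Gamma -> A \in unitmx)
    (Gamma_1 : 1%:M \in Gamma)
    (Gamma_mul : forall A B, A \in Gamma -> B \in Gamma -> A *m B \in Gamma)
    (Gamma_inv : forall A, A \in Gamma -> invmx A \in Gamma)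
    (n_ge1 : (1 <= n)%N) :
  forall (g : 'I_n -> 'M[Cplx R]_k) (s : 'S_n),
    (forall i, g i \in Gamma) ->
    lambdaCkn g s = etaLambda g s.
Proof. by move=> g s _; rewrite lambdaCkn_sum etaLambda_sum. Qed.
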